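(* Let $R = k[x_1,\dots,x_n]$ be a polynomial ring over a field $k$. Let $I = J + fH$, where $J$ and $H$ are homogeneous ideals in $R$ and $f$ is a linear form that is a non-zerodivisor of $R/J$. Then (i) $\operatorname{depth} R/I \in \{ \operatorname{depth} R/(J+H),\ \operatorname{depth} R/J - 1\}$; (ii) $\operatorname{reg} R/I \in \{\operatorname{reg} R/(J+H)+1,\ \operatorname{reg} R/J\}$.
   Context: $R$ has the standard grading and $\mathfrak m=(x_1,\dots,x_n)$. For a finitely generated graded $R$-module $M$ with local cohomology modules $H^i_{\mathfrak m}(M)$, $\operatorname{depth} M := \min\{ i \mid H^i_{\mathfrak m}(M) \neq 0\}$ and $\operatorname{reg} M := \max\{i+j \mid H^i_{\mathfrak m}(M)_j \neq 0\}$ (Castelnuovo-Mumford regularity). By the usual convention the zero module has depth $+\infty$ and regularity $-\infty$. *)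

(* Defs.v *)
From HB Require Import structures.
From mathcomp Require Import all_boot all_order all_algebra.
From mathcomp Require Import ring_quotient.
From mathcomp Require Import mpoly.
From mathcomp Require Import boolp classical_sets constructive_ereal.

Set Implicit Arguments.
Unset Strict Implicit.
Unset Printing Implicit Defensive.

Import Order.TTheory GRing.Theory Num.Theory.

Local Open Scope ring_scope.
Local Open Scope quotient_scope.
Local Open Scope classical_set_scope.

Section QuotientModule.
Variables (R : nzRingType) (V : lmodType R).

(* [submodClosed] only records stability under addition and scaling, whereas
   [Quotient.quot] asks for a [zmodClosed] predicate. *)
Definition submod_pred (N : submodClosed V) : {pred V} := N.

Lemma submod_pred_zmod_closed N : zmod_closed (submod_pred N).
Proof.
split=> [|x y Nx Ny]; first exact: (@rpred0 _ N).
by rewrite /submod_pred -scaleN1r; apply: (@rpredD _ N) => //; apply: rpredZ.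
Qed.

HB.instance Definition _ N := GRing.isZmodClosed.Build V (submod_pred N)
  (submod_pred_zmod_closed N).

Variable N : submodClosed V.

Definition quotmod := Quotient.quot (submod_pred N).
HB.instance Definition _ := GRing.Zmodule.on quotmod.
HB.instance Definition _ := EqQuotient.on quotmod.

Definition quotmod_scale (a : R) := lift_op1 quotmod ( *:%R a).

Lemma pi_quotmod_scale a :
  {morph \pi_quotmod : x / a *: x >-> quotmod_scale a x}.
Proof.
move=> x; unlock quotmod_scale; apply/eqP.
rewrite -[_ == _]Quotient.idealrBE -scalerBr.
apply: (@rpredZ _ _ N); rewrite -[_ \in _]/(_ \in submod_pred N).
by rewrite Quotient.idealrBE reprK.
Qed.

Lemma pi_quotmodD : {morph \pi_quotmod : x y / x + y}.
Proof. exact: Quotient.pi_add. Qed.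

Fact quotmod_scalerA a b x :
  quotmod_scale a (quotmod_scale b x) = quotmod_scale (a * b) x.
Proof. by rewrite -[x]reprK -!pi_quotmod_scale scalerA. Qed.

Fact quotmod_scale1r : left_id 1 quotmod_scale.
Proof. by move=> x; rewrite -[x]reprK -!pi_quotmod_scale scale1r. Qed.

Fact quotmod_scalerDr : right_distributive quotmod_scale +%R.
Proof.
move=> a x y; rewrite -[x]reprK -[y]reprK.
by rewrite -pi_quotmodD -!pi_quotmod_scale scalerDr pi_quotmodD.
Qed.

Fact quotmod_scalerDl x : {morph quotmod_scale^~ x : a b / a + b}.
Proof.
by move=> a b; rewrite -[x]reprK -!pi_quotmod_scale scalerDl pi_quotmodD.
Qed.

HB.instance Definition _ := GRing.Zmodule_isLmodule.Build R quotmod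
  quotmod_scalerA quotmod_scale1r quotmod_scalerDr quotmod_scalerDl.

End QuotientModule.


Notation ideal R := (submodClosed R^o).

Section Ideals.
Variable R : comNzRingType.
Implicit Types (I J H : ideal R) (f : R).

Definition quot_ideal I : lmodType R := quotmod I.

Definition ideal_add J H : {pred R^o} :=
  fun p => `[< exists2 a, a \in J & exists2 b, b \in H & p = a + b >].

Fact ideal_add_closed J H : submod_closed (ideal_add J H).
Proof.
split=> [|a p q /asboolP [x Jx [y Hy ->]] /asboolP [z Jz [w Hw ->]]];
  apply/asboolP.
  by exists 0; rewrite ?rpred0//; exists 0; rewrite ?rpred0// addr0.
exists (a *: x + z); first by rewrite rpredD ?rpredZ.
exists (a *: y + w); first by rewrite rpredD ?rpredZ.
by rewrite scalerDr addrACA.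
Qed.

HB.instance Definition _ J H := GRing.isSubmodClosed.Build R R^o
  (ideal_add J H) (ideal_add_closed J H).

Definition ideal_scale f H : {pred R^o} :=
  fun p => `[< exists2 h, h \in H & p = f * h >].

Fact ideal_scale_closed f H : submod_closed (ideal_scale f H).
Proof.
split=> [|a p q /asboolP [x Hx ->] /asboolP [y Hy ->]]; apply/asboolP.
  by exists 0; rewrite ?rpred0// mulr0.
exists (a *: x + y); first by rewrite rpredD ?rpredZ.
by rewrite mulrDr; congr (_ + _); rewrite /GRing.scale/= mulrCA.
Qed.

HB.instance Definition _ f H := GRing.isSubmodClosed.Build R R^o
  (ideal_scale f H) (ideal_scale_closed f H).

Definition nonzerodivisor f (M : lmodType R) :=
  forall m : M, f *: m = 0 -> m = 0.

End Ideals.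

(* Local cohomology with support in the irrelevant ideal, as the cohomology of
   the Cech complex
     C^i(M) = \bigoplus_(#|S| = i) M_{x_S},  x_S = \prod_(v in S) x_v. *)
Section LocalCohomology.
Variables (k : fieldType) (n : nat) (M : lmodType {mpoly k[n]}).
Local Notation R := {mpoly k[n]}.
Implicit Types (c b : {set 'I_n} -> M) (S T : {set 'I_n}) (i t : nat).

Definition xprod S : R := \prod_(v in S) 'X_v.

(* [eqfrac x m s m' s'] is the equality m / x^s = m' / x^s' in M_x. *)
Definition eqfrac (x : R) (m : M) (s : nat) (m' : M) (s' : nat) :=
  exists u, x ^+ u *: (x ^+ s' *: m - x ^+ s *: m') = 0.

(* A pair (c, t) stands for the cochain (c S / (xprod S)^t)_S; being finite, the
   family can always be put over a common exponent t. In degree i, only the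
   values c S with #|S| = i are relevant.
   The image of c (T :\ v) / (xprod (T :\ v))^t in M_{x_T} is
   ('X_v ^+ t *: c (T :\ v)) / (xprod T)^t, so that the differential keeps the
   exponent t. *)
Definition cech_diff c t T : M :=
  \sum_(v in T)
    (-1) ^+ #|[set u in T | (u < v)%N]| *: ('X_v ^+ t *: c (T :\ v)).

Definition cocycle i c t :=
  forall T, #|T| = i.+1 -> eqfrac (xprod T) (cech_diff c t T) t 0 0.

Definition coboundary i c t :=
  exists b s, forall S, #|S| = i ->
    eqfrac (xprod S) (c S) t (cech_diff b s S) s.

(* H^i(M) != 0 *)
Definition loccoh_neq0 i :=
  exists c t, cocycle i c t /\ ~ coboundary i c t.

(* G j is the component of degree j of M. A homogeneous element of degree j of
   M_{x_S} is a fraction whose numerator over (xprod S)^t has degree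
   j + t * #|S|. *)
Implicit Type G : int -> set M.

Definition homog_cochain G i (j : int) c t :=
  forall S, #|S| = i -> G (j + (t * i)%:Z) (c S).

(* H^i(M)_j != 0 *)
Definition loccoh_comp_neq0 G i j :=
  exists c t, [/\ homog_cochain G i j c t, cocycle i c t & ~ coboundary i c t].

Definition depth : \bar int :=
  infimum +oo%E [set d | exists2 i, loccoh_neq0 i & d = (i%:Z)%:E].

(* For a finitely generated graded module the set is bounded above, so that the
   supremum is a maximum, or -oo if the set is empty. *)
Definition reg G : \bar int :=
  supremum -oo%E
    [set r | exists i j, loccoh_comp_neq0 G i j /\ r = (i%:Z + j)%:E].

End LocalCohomology.

Section StandardGrading.
Variables (k : fieldType) (n : nat).
Local Notation R := {mpoly k[n]}.

Definition mpoly_grading (j : int) : set R :=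
  match j with
  | Posz d => [set p | p \is d.-homog]
  | Negz _ => [set 0]
  end.

Definition homogeneous_ideal (I : ideal R) :=
  forall p d, p \in I -> pihomog mdeg d p \in I.

Definition quot_grading (I : ideal R) (j : int) : set (quot_ideal I) :=
  \pi_(quotmod I) @` mpoly_grading j.

Definition depth_quot (I : ideal R) : \bar int := depth (quot_ideal I).

Definition reg_quot (I : ideal R) : \bar int := reg (@quot_grading I).

End StandardGrading.

(* Main.v *)
Require Import Defs.
From mathcomp Require Import all_boot all_order all_algebra.
From mathcomp Require Import ring_quotient.
From mathcomp Require Import mpoly.
From mathcomp Require Import boolp classical_sets constructive_ereal.
From mathcomp Require Import ring zify.

(** Write R for the polynomial ring, P = J + H and I = J + f P; the latter is
J + f H because f J lies in J.  As f is regular modulo J, there are two short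
exact sequences of graded modules

   0 -> P/J -> R/J -> R/P -> 0    and    0 -> (P/J)(-1) -> R/J -> R/I -> 0,

the second one starting with multiplication by f.  On local cohomology the two
maps out of H^i(P/J) thus differ by the action of f on H^i(R/J), and every
element of H^i(R/J) is killed by a power of f, a linear form.  Three kinds of
facts result, valid in each degree j, where index i - 1 is void for i = 0.

 - [vanishes_P]: if H^i(R/J)_j and H^i(R/I)_(j+1) vanish, so does H^i(R/P)_j.
   A class of H^i(R/P)_j embeds in H^(i+1)(P/J)_j, dies in H^(i+1)(R/J)_j, and
   so comes from H^i(R/I)_(j+1).
 - [vanishes_I]: if H^i(R/J)_(j+1), H^(i+1)(R/J)_j and H^i(R/P)_j vanish, so
   does H^i(R/I)_(j+1): it embeds in H^(i+1)(P/J)_j, which is zero.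
 - [vanishes_J_of_I], [vanishes_J_of_P]: suppose that H^(i-1)(R/I) vanishes in
   all degrees above j, so that f times the inclusion is injective on H^i(P/J)
   in degrees at least j.  A nonzero class in the image of H^i(P/J)_j would
   then survive all powers of f in H^i(R/J), which is absurd.  Hence H^i(R/J)_j
   is zero as soon as H^i(P/J)_j maps onto it, and it does if H^i(R/P)_j or
   H^i(R/I)_j vanishes.

What remains is arithmetic.  If depth R/I is a finite number b then H^i(R/J)
and H^i(R/P) vanish for i < b; either H^b(R/P) is nonzero and depth R/P = b, or
H^b(R/J) = 0 and H^(b+1)(R/J) is not, so depth R/J = b + 1.  For the
regularity, the third fact gives reg R/J <= reg R/I, and if the inequality is
strict the first two facts identify H^i(R/I)_(j+1) and H^i(R/P)_j as far as
vanishing above the weight reg R/J is concerned, whence reg R/I = reg R/P + 1.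

The cohomology of the Cech complex is the direct limit over t of the cohomology
of the Koszul complexes on x_1^t, ..., x_n^t, and the connecting maps are traced
there on cochains with polynomial values, congruences modulo J, P and I taking
the place of quotient modules.  Depth and regularity are handled by the same
lemmas, in which the grading is a family of projections: the homogeneous
components for regularity, identity maps for depth. *)

Set Implicit Arguments.
Unset Strict Implicit.
Unset Printing Implicit Defensive.

Import Order.TTheory GRing.Theory Num.Theory.

Local Open Scope ring_scope.

(** * The Koszul complex on powers of a sequence *)

Section Koszul.
Variables (R : comNzRingType) (n : nat) (x : 'I_n -> R).
Implicit Types (S T : {set 'I_n}) (c b : {set 'I_n} -> R) (t u : nat).

Definition ksign T (v : 'I_n) : R := (-1) ^+ #|[set u in T | (u < v)%N]|.

(** The differential of the Koszul cochain complex on the x v ^+ t, on all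
cochain degrees at once: a cochain is one function on all index sets, and its
part of degree i is its restriction to the sets of size i. *)
Definition kdiff t c T : R :=
  \sum_(v in T) ksign T v * (x v ^+ t * c (T :\ v)).

Definition kprod S : R := \prod_(v in S) x v.

Lemma ksign_sqr T v : ksign T v * ksign T v = 1.
Proof. by rewrite -expr2 sqrr_sign. Qed.

Lemma ksign_gt T (v w : 'I_n) : (v <= w)%N -> ksign (T :\ w) v = ksign T v.
Proof.
move=> vw; congr (_ ^+ _); apply: eq_card => u; rewrite !inE.
by have [->|//] := eqVneq u w; rewrite ltnNge vw /= !andbF.
Qed.

Lemma ksign_lt T (v w : 'I_n) : v \in T -> (v < w)%N ->
  ksign (T :\ v) w = - ksign T w.
Proof.
move=> vT vw; rewrite /ksign [in RHS](cardsD1 v) inE vT vw /= exprS mulN1r.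
rewrite opprK.
by congr (_ ^+ _); apply: eq_card => u; rewrite !inE andbA.
Qed.

(** Removing two indices in either order gives opposite signs; this is what
makes the differential square to zero. *)
Lemma ksign_swap T v w : v \in T -> w \in T -> v != w ->
  ksign T v * ksign (T :\ v) w = - (ksign T w * ksign (T :\ w) v).
Proof.
move=> vT wT; rewrite neq_ltn => /orP[] lt.
  by rewrite (ksign_lt vT lt) (ksign_gt T (ltnW lt)) mulrN mulrC.
by rewrite (ksign_lt wT lt) (ksign_gt T (ltnW lt)) mulrN opprK mulrC.
Qed.

Lemma ksign_swap_del T v w : v \in T -> w \in T -> v != w ->
  ksign (T :\ v) w * ksign (T :\ w) v = - (ksign T v * ksign T w).
Proof.
move=> vT wT vw; have := ksign_swap vT wT vw.
move: (ksign_sqr T v) (ksign_sqr (T :\ w) v).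
move: (ksign T v) (ksign T w) (ksign (T :\ w) v) (ksign (T :\ v) w).
move=> a c d b aa dd ab.
have -> : b * d = a * a * (b * d) by rewrite aa mul1r.
have -> : a * a * (b * d) = a * d * (a * b) by ring.
have -> : a * d * (a * b) = - (a * c * (d * d)) by rewrite ab; ring.
by rewrite dd mulr1.
Qed.

Lemma kdiffB t c b T :
  kdiff t (fun S => c S - b S) T = kdiff t c T - kdiff t b T.
Proof. by rewrite -sumrB; apply: eq_bigr => v _; ring. Qed.

Lemma kdiffZ t g c T : kdiff t (fun S => g * c S) T = g * kdiff t c T.
Proof. by rewrite mulr_sumr; apply: eq_bigr => v _; ring. Qed.

(** The Koszul complexes on the powers t and t + u are related by the chain map
that multiplies the S-component by kprod S ^+ u.  In the localization it turns
a numerator over kprod S ^+ t into one over kprod S ^+ (t + u), so that the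
direct limit along these maps is the Cech complex. *)
Lemma kdiff_shift t u c T :
  kdiff (t + u) (fun S => kprod S ^+ u * c S) T = kprod T ^+ u * kdiff t c T.
Proof.
rewrite mulr_sumr; apply: eq_bigr => v vT.
by rewrite {2}/kprod (big_setD1 v) //= exprMn exprD -/(kprod _); ring.
Qed.

Lemma kdiffK t c T : kdiff t (kdiff t c) T = 0.
Proof.
pose F v w := ksign T v * ksign (T :\ v) w *
  (x v ^+ t * x w ^+ t * c (T :\: [set v; w])).
have Fswap v w : v \in T -> w \in T -> v != w -> F v w = - F w v.
  by move=> vT wT vw; rewrite /F ksign_swap // (finset.setUC [set w]); ring.
transitivity (\sum_(v in T) \sum_(w in T | v != w) F v w).
  apply: eq_bigr => v vT; rewrite mulr_sumr mulr_sumr.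
  apply: eq_big => [w|w]; first by rewrite !inE andbC eq_sym.
  by move=> _; rewrite finset.setDDl /F; ring.
(* Antisymmetry alone is too weak in characteristic 2: the terms must be paired
   off. *)
pose lt (v w : 'I_n) := (v < w)%N.
transitivity (\sum_(v in T) \sum_(w in T | lt v w) F v w +
              \sum_(v in T) \sum_(w in T | lt w v) F v w).
  rewrite -big_split; apply: eq_bigr => v vT /=.
  rewrite (bigID (lt v)) /=; congr (_ + _); apply: eq_bigl => w.
    by rewrite -andbA -val_eqE neq_ltn /lt; case: ltngtP; rewrite ?andbF.
  by rewrite -andbA -val_eqE neq_ltn /lt; case: ltngtP; rewrite ?andbF.
rewrite [X in _ + X](exchange_big_dep (mem T)) /=; last by move=> v w _ /andP[].
rewrite -big_split /= big1 // => v vT.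
rewrite [X in _ + X](eq_bigl (fun w => (w \in T) && lt v w)); last first.
  by move=> w; rewrite vT.
rewrite -big_split big1 //= => w /andP[wT lvw].
by rewrite Fswap ?addNr // -val_eqE neq_ltn -[(v < w)%N]/(lt v w) lvw.
Qed.

Definition kcontr v c S : R := if v \in S then 0 else ksign S v * c (v |: S).

(** Contraction against the index v is a homotopy from multiplication by
x v ^+ t to zero; hence x v ^+ t kills the Koszul cohomology of level t. *)
Lemma kcontrP t v c T :
  x v ^+ t * c T = kdiff t (kcontr v c) T + kcontr v (kdiff t c) T.
Proof.
rewrite /kcontr; case: ifP => vT.
  rewrite addr0 /kdiff (bigD1 v) //= big1 ?addr0 => [|w /andP[wT wv]].
    rewrite finset.setD11 finset.setD1K // ksign_gt //.
    by rewrite -[LHS]mul1r -(ksign_sqr T v); ring.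
  by rewrite !inE eq_sym wv vT !mulr0.
have sv : ksign (v |: T) v = ksign T v.
  by rewrite -(ksign_gt (v |: T) (leqnn v)) finset.setU1K ?vT.
rewrite /kdiff (big_setU1 v) ?vT //= finset.setU1K ?vT // mulrDr sv.
rewrite addrCA mulrA ksign_sqr mul1r mulr_sumr -big_split /=.
rewrite big1 ?addr0 // => w wT.
have vw : v != w by apply: contraFneq vT => ->.
have vTw : v \notin T :\ w by rewrite !inE vT andbF.
rewrite (negbTE vTw).
have vTwE : (v |: T) :\ w = v |: (T :\ w).
  by apply/setP => z; rewrite !inE; case: (eqVneq z v) => // ->; rewrite vw.
rewrite vTwE; have := @ksign_swap_del (v |: T) v w.
rewrite !inE eqxx wT orbT => /(_ isT isT vw).
rewrite finset.setU1K ?vT // sv.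
have -> : ksign ((v |: T) :\ w) v = ksign (T :\ w) v.
  by rewrite vTwE -(ksign_gt (v |: _) (leqnn v)) finset.setU1K.
move=> swap; transitivity (x w ^+ t * c (v |: T :\ w) *
    (ksign T w * ksign (T :\ w) v + ksign T v * ksign (v |: T) w)).
  by ring.
by rewrite swap addNr mulr0.
Qed.
End Koszul.

(** * Koszul cochains modulo an ideal *)

Lemma idealMl (R : comNzRingType) (Q : ideal R) (a p : R) :
  p \in Q -> a * p \in Q.
Proof. exact: (@rpredZ R R^o Q). Qed.

Lemma idealN (R : comNzRingType) (Q : ideal R) (p : R) :
  (- p \in Q) = (p \in Q).
Proof.
have QN q : q \in Q -> - q \in Q by rewrite -mulN1r; apply: idealMl.
by apply/idP/idP => [/QN|/QN //]; rewrite opprK.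
Qed.

Lemma idealB (R : comNzRingType) (Q : ideal R) (p q : R) :
  p \in Q -> q \in Q -> p - q \in Q.
Proof. by move=> pQ qQ; apply: (@rpredD _ Q) => //; rewrite idealN. Qed.

Section IdealMembership.
Variables (R : comNzRingType) (n : nat) (x : 'I_n -> R) (Q : ideal R).
Implicit Types (S T : {set 'I_n}) (c b : {set 'I_n} -> R) (t u i : nat).

Lemma kdiff_mem t i c T : (forall S, #|S| = i -> c S \in Q) ->
  #|T| = i.+1 -> kdiff x t c T \in Q.
Proof.
move=> cQ Ti; apply: rpred_sum => v vT; do 2 apply: idealMl.
by apply: cQ; move: Ti; rewrite (cardsD1 v) vT => -[].
Qed.

Definition kcocycle i t c := forall T, #|T| = i.+1 -> kdiff x t c T \in Q.

(** Being a coboundary after passing to some level t + u amounts to having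
class zero in the direct limit. *)
Definition kcoboundary i t c := exists u b, forall S, #|S| = i ->
  kprod x S ^+ u * c S - kdiff x (t + u) b S \in Q.
End IdealMembership.

Section Graded.
Variables (R : comNzRingType) (n : nat) (x : 'I_n -> R).
Variable pr : int -> {additive R -> R}.

(** A grading enters only through its projections pr e, and a homogeneous
element of degree d only through the fact that multiplication by it commutes
with them up to a shift by d.  With identity maps for pr, every element
qualifies and the notions below forget the degree. *)
Definition hom_mult (d : nat) (g : R) :=
  forall e p, pr (e + d%:Z) (g * p) = g * pr e p.
Hypothesis prK : forall e p, pr e (pr e p) = pr e p.
Hypothesis x_hom : forall v, hom_mult 1 (x v).
Implicit Types (S T : {set 'I_n}) (c b : {set 'I_n} -> R) (t u i : nat).
Implicit Types (j : int) (Q : ideal R).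

Definition pr_stable Q := forall e p, p \in Q -> pr e p \in Q.

(** The numerator over kprod S ^+ t of a fraction of degree j has degree
j + t * #|S|. *)
Definition kcochain j t c := forall S, pr (j + (t * #|S|)%:Z) (c S) = c S.

(** The component of degree j of the i-th local cohomology of R / Q is zero. *)
Definition vanishes Q i j := forall t c,
  kcochain j t c -> kcocycle x Q i t c -> kcoboundary x Q i t c.

Lemma hom_multM d e g h :
  hom_mult d g -> hom_mult e h -> hom_mult (e + d) (g * h).
Proof. by move=> gd he a p; rewrite PoszD addrA -!mulrA gd he. Qed.

Lemma hom_multX g d m : hom_mult d g -> hom_mult (m * d) (g ^+ m).
Proof.
move=> gd; elim: m => [|m IH]; first by move=> e p; rewrite addr0 !mul1r.
by rewrite exprS mulSn addnC; apply: hom_multM.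
Qed.

Lemma hom_mult_kprod S : hom_mult #|S| (kprod x S).
Proof.
rewrite /kprod -sum1_card; elim/big_rec2: _ => [|v d g _ IH].
  by move=> e p; rewrite addr0 !mul1r.
by rewrite addnC; apply: hom_multM.
Qed.

Lemma kcochain_shift j t u c : kcochain j t c ->
  kcochain j (t + u) (fun S => kprod x S ^+ u * c S).
Proof.
move=> cj S; rewrite mulnDl PoszD addrA.
by rewrite (hom_multX u (hom_mult_kprod S)) cj.
Qed.

Lemma kcochainB j t c b : kcochain j t c -> kcochain j t b ->
  kcochain j t (fun S => c S - b S).
Proof. by move=> cj bj S; rewrite raddfB cj bj. Qed.

Lemma kcochainM d g j t c : hom_mult d g -> kcochain j t c ->
  kcochain (j + d%:Z) t (fun S => g * c S).
Proof. by move=> gd cj S; rewrite addrAC gd cj. Qed.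

Lemma pr_ksign e T v p : pr e (ksign R T v * p) = ksign R T v * pr e p.
Proof.
by rewrite /ksign -signr_odd !mulr_sign; case: (odd _); rewrite ?raddfN.
Qed.

Lemma pr_kdiff j t b T :
  pr (j + (t * #|T|)%:Z) (kdiff x t b T) =
  kdiff x t (fun S => pr (j + (t * #|S|)%:Z) (b S)) T.
Proof.
rewrite raddf_sum; apply: eq_bigr => v vT; rewrite pr_ksign; congr (_ * _).
rewrite (cardsD1 v T) vT mulnDr addnC PoszD addrA.
exact: (hom_multX t (x_hom v)).
Qed.

Lemma kcochain_kdiff j t c : kcochain j t c -> kcochain j t (kdiff x t c).
Proof.
by move=> cj S; rewrite pr_kdiff; apply: eq_bigr => v _; rewrite cj.
Qed.

(** Projecting a bounding cochain to the right degree changes nothing, since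
the differential respects degrees. *)
Lemma kcoboundary_homog Q i j t c : pr_stable Q -> kcochain j t c ->
  kcoboundary x Q i t c -> exists u b, kcochain j (t + u) b /\
   forall S, #|S| = i -> kprod x S ^+ u * c S - kdiff x (t + u) b S \in Q.
Proof.
move=> Qs cj [u [b bE]].
exists u, (fun S => pr (j + ((t + u) * #|S|)%:Z) (b S)).
split=> [S|S Si]; first exact: prK.
rewrite -pr_kdiff -(kcochain_shift u cj) -raddfB; exact/Qs/bE.
Qed.

Section LinearForm.
Variables (J P I : ideal R) (f : R).
Hypothesis f_hom : hom_mult 1 f.
Hypothesis f_nilp : forall t, exists m (g : 'I_n -> R),
  f ^+ m = \sum_v g v * x v ^+ t.
Hypothesis f_reg : forall g, f * g \in J -> g \in J.
Hypothesis sub_J_P : forall g, g \in J -> g \in P.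
Hypothesis IE : forall g, g \in I <-> exists2 p, p \in P & g - f * p \in J.
Hypotheses (Js : pr_stable J) (Ps : pr_stable P).

Lemma sub_J_I g : g \in J -> g \in I.
Proof. by move=> gJ; apply/IE; exists 0; rewrite ?rpred0 // mulr0 subr0. Qed.

Lemma mulf_P_I g : g \in P -> f * g \in I.
Proof. by move=> gP; apply/IE; exists g; rewrite // subrr rpred0. Qed.

Lemma sub_I_P g : g \in I -> g \in P.
Proof.
by move/IE=> [p pP /sub_J_P]; move/rpredD/(_ (idealMl f pP)); rewrite subrK.
Qed.

Lemma pr_stable_I : pr_stable I.
Proof.
move=> e g /IE[p pP gp]; apply/IE; exists (pr (e - 1) p); first exact: Ps.
by rewrite -f_hom subrK -raddfB; apply: Js.
Qed.

(** The connecting maps of the second sequence involve dividing by f modulo J;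
this performs the division on a whole cochain. *)
Lemma divide_mod_J i j t g : kcochain (j + 1) t g ->
  (forall S, #|S| = i -> g S \in I) ->
  exists p, [/\ forall S, p S \in P, kcochain j t p &
                forall S, #|S| = i -> g S - f * p S \in J].
Proof.
move=> gj gI.
have /fin_all_exists[p pP] : forall S, exists q, [/\ q \in P,
    pr (j + (t * #|S|)%:Z) q = q & #|S| = i -> g S - f * q \in J].
  move=> S; have [/eqP Si|Si] := boolP (#|S| == i); last first.
    by exists 0; rewrite raddf0 rpred0; split=> // /eqP; rewrite (negbTE Si).
  have /IE[q qP gq] := gI S Si.
  exists (pr (j + (t * #|S|)%:Z) q); split=> [||_].
  - exact: Ps.
  - exact: prK.
  rewrite -f_hom addrAC -(gj S) -raddfB; exact: Js.
by exists p; split=> S; have [] := pP S.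
Qed.

(** For a cocycle c modulo P, f c is a cocycle modulo I; modulo J, a bounding
cochain of it has boundary f (c - p) with values of p in P.  Then c - p is a
cocycle modulo J that represents the same class as c. *)
Lemma vanishes_P i j :
  vanishes J i j -> vanishes I i (j + 1) -> vanishes P i j.
Proof.
move=> vJ vI t c cj cP.
have fcI : kcocycle x I i t (fun S => f * c S).
  by move=> T Ti; rewrite kdiffZ; apply/mulf_P_I/cP.
have fcj := kcochainM f_hom cj.
have [u [b [bj bE]]] := kcoboundary_homog pr_stable_I fcj (vI _ _ fcj fcI).
have gj : kcochain (j + 1) (t + u)
    (fun S => kprod x S ^+ u * (f * c S) - kdiff x (t + u) b S).
  by apply: kcochainB; [exact: kcochain_shift|exact: kcochain_kdiff].
have [p [pP pj pE]] := divide_mod_J gj bE.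
pose c' S := kprod x S ^+ u * c S - p S.
have c'j : kcochain j (t + u) c'.
  by apply: kcochainB => //; exact: kcochain_shift.
have c'J : kcocycle x J i (t + u) c'.
  move=> T Ti; apply: f_reg; rewrite -kdiffZ.
  have := kdiff_mem x (t + u) pE Ti.
  rewrite kdiffB kdiffB kdiffK subr0 -kdiffB.
  congr (_ \in J); apply: eq_bigr => v _; rewrite /c'; ring.
have [u' [b' b'E]] := vJ _ _ c'j c'J.
exists (u + u')%N, b' => S Si; rewrite addnA.
have -> : kprod x S ^+ (u + u') * c S - kdiff x (t + u + u') b' S =
    kprod x S ^+ u' * c' S - kdiff x (t + u + u') b' S + kprod x S ^+ u' * p S.
  by rewrite /c' exprD; ring.
by apply: rpredD; [exact/sub_J_P/b'E|exact: idealMl].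
Qed.

(** For a cocycle c modulo I, the boundary of c is f p modulo J with p a
cocycle modulo J, hence p is the boundary modulo J of some b, which is a cocycle
modulo P.  As b is then the boundary of some b' up to a cochain q with values
in P, subtracting f q from c leaves a cocycle modulo J. *)
Lemma vanishes_I i j :
  vanishes J i (j + 1) -> vanishes J i.+1 j -> vanishes P i j ->
  vanishes I i (j + 1).
Proof.
move=> vJ vJ1 vP t c cj cI.
have [p [pP pj pE]] := divide_mod_J (kcochain_kdiff cj) cI.
have pJ : kcocycle x J i.+1 t p.
  move=> T Ti; apply: f_reg; rewrite -kdiffZ.
  by have := kdiff_mem x t pE Ti; rewrite kdiffB kdiffK sub0r idealN.
have [u [b [bj bE]]] := kcoboundary_homog Js pj (vJ1 _ _ pj pJ).
have bP : kcocycle x P i (t + u) b.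
  move=> T Ti; rewrite -[kdiff _ _ _ _](subKr (kprod x T ^+ u * p T)).
  by rewrite idealB ?idealMl //; apply/sub_J_P/bE.
have [u' [b' [b'j b'E]]] := kcoboundary_homog Ps bj (vP _ _ bj bP).
pose q S := kprod x S ^+ u' * b S - kdiff x (t + u + u') b' S.
have qj : kcochain j (t + u + u') q.
  by apply: kcochainB; [exact: kcochain_shift|exact: kcochain_kdiff].
pose c' S := kprod x S ^+ u' * (kprod x S ^+ u * c S) - f * q S.
have c'j : kcochain (j + 1) (t + u + u') c'.
  by apply: kcochainB; [do 2 apply: kcochain_shift|exact: kcochainM].
have c'J : kcocycle x J i (t + u + u') c'.
  move=> T Ti.
  rewrite kdiffB kdiffZ !kdiff_shift kdiffB kdiffK subr0 kdiff_shift.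
  set d := kdiff x t c T; set d' := kdiff x (t + u) b T.
  have -> : kprod x T ^+ u' * (kprod x T ^+ u * d) - f * (kprod x T ^+ u' * d')
    = kprod x T ^+ u' * (kprod x T ^+ u * (d - f * p T)
       + f * (kprod x T ^+ u * p T - d')) by ring.
  by apply: idealMl; apply: rpredD; apply: idealMl; [exact: pE|exact: bE].
have [u'' [b'' b''E]] := vJ _ _ c'j c'J.
exists (u + u' + u'')%N, b'' => S Si; rewrite !addnA.
set d := kdiff _ _ _ _.
have -> : kprod x S ^+ (u + u' + u'') * c S - d =
    kprod x S ^+ u'' * c' S - d + f * (kprod x S ^+ u'' * q S).
  by rewrite /c' !exprD; ring.
by apply: rpredD; [exact/sub_J_I/b''E|apply/mulf_P_I/idealMl/b'E].
Qed.

(** Injectivity of f times the inclusion from the i-th cohomology of P / J to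
that of R / J: its kernel is a quotient of the (i - 1)-th cohomology of
R / I. *)
Lemma kcoboundary_divf i j t y :
  (forall i', i = i'.+1 -> vanishes I i' (j + 1)) ->
  kcochain j t y -> (forall S, #|S| = i -> y S \in P) ->
  kcoboundary x J i t (fun S => f * y S) -> kcoboundary x J i t y.
Proof.
move=> vI yj yP /(kcoboundary_homog Js (kcochainM f_hom yj))[u [b [bj bE]]].
case: i => [|i] in vI yP bE *.
  (* The empty set bounds nothing, and regularity of f is enough. *)
  exists u, (fun=> 0) => S S0; apply: f_reg; move: (bE S S0).
  have /eqP := S0; rewrite cards_eq0 => /eqP ->.
  by rewrite /kdiff !big_set0 !subr0; congr (_ \in J); ring.
have bI : kcocycle x I i (t + u) b.
  move=> T Ti.
  rewrite -[kdiff _ _ _ _](subKr (kprod x T ^+ u * (f * y T))).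
  by apply: idealB; [exact/idealMl/mulf_P_I/yP|exact/sub_J_I/bE].
have [u' [b' [b'j b'E]]] :=
  kcoboundary_homog pr_stable_I bj (vI i erefl _ _ bj bI).
pose g S := kprod x S ^+ u' * b S - kdiff x (t + u + u') b' S.
have gj : kcochain (j + 1) (t + u + u') g.
  by apply: kcochainB; [exact: kcochain_shift|exact: kcochain_kdiff].
have [p [pP pj pE]] := divide_mod_J gj b'E.
exists (u + u')%N, p => S Si; apply: f_reg; rewrite addnA.
have := kdiff_mem x (t + u + u') pE Si.
rewrite kdiffB kdiffZ kdiffB kdiffK subr0 kdiff_shift => pS.
set d := kdiff x _ p S in pS *; set d' := kdiff x _ b S in pS *.
have -> : f * (kprod x S ^+ (u + u') * y S - d) =
  kprod x S ^+ u' * (kprod x S ^+ u * (f * y S) - d')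
  + (kprod x S ^+ u' * d' - f * d) by rewrite exprD; ring.
by apply: rpredD => //; apply/idealMl/bE.
Qed.

(** Local cohomology is f-torsion.  A high power of f is a combination of the
x v ^+ t, and the homotopies [kcontr] give an explicit bounding cochain. *)
Lemma kcoboundary_expf i t y : kcocycle x J i t y ->
  exists m, kcoboundary x J i t (fun S => f ^+ m * y S).
Proof.
move=> yJ; have [m [g fE]] := f_nilp t; exists m.
exists 0%N, (fun S => \sum_v g v * kcontr v y S) => S Si.
rewrite expr0 mul1r addn0 fE.
have -> : kdiff x t (fun S => \sum_v g v * kcontr v y S) S =
    \sum_v g v * kdiff x t (kcontr v y) S.
  rewrite /kdiff.
  under eq_bigr do rewrite !mulr_sumr.
  by rewrite exchange_big; apply: eq_bigr => v _; rewrite mulr_sumr;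
    apply: eq_bigr => w _; ring.
rewrite mulr_suml -sumrB; apply: rpred_sum => v _.
rewrite -mulrA (kcontrP x) -mulrBr addrC addKr.
apply: idealMl; rewrite /kcontr; case: ifP => [_|vS]; first exact: rpred0.
by apply/idealMl/yJ; rewrite cardsU1 vS Si.
Qed.

(** The powers of f are stripped off one by one, each time in a higher degree;
this is why vanishing is needed in all degrees above j. *)
Lemma kcoboundary_of_kcocycle_P i j t y :
  (forall i' j', i = i'.+1 -> j < j' -> vanishes I i' j') ->
  kcochain j t y -> (forall S, #|S| = i -> y S \in P) -> kcocycle x J i t y ->
  kcoboundary x J i t y.
Proof.
move=> vI yj yP yJ; have [m] := kcoboundary_expf yJ.
elim: m => [|m IH] ym.
  by have [u [b bE]] := ym; exists u, b => S /bE; rewrite mul1r.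
apply: IH; apply: (@kcoboundary_divf _ (j + m%:Z)).
- by move=> i' ei; apply: vI => //; lia.
- by apply: kcochainM => //; have := hom_multX m f_hom; rewrite muln1.
- by move=> S /yP; apply: idealMl.
by have [u [b bE]] := ym; exists u, b => S /bE; rewrite exprS -mulrA.
Qed.

(** A class of R / J that dies in R / P is represented by a cocycle with values
in P. *)
Lemma kcoboundary_of_mod_P i j t c :
  (forall i' j', i = i'.+1 -> j < j' -> vanishes I i' j') ->
  kcochain j t c -> kcocycle x J i t c ->
  kcoboundary x P i t c -> kcoboundary x J i t c.
Proof.
move=> vI cj cJ /(kcoboundary_homog Ps cj)[u [b [bj bE]]].
pose w S := kprod x S ^+ u * c S - kdiff x (t + u) b S.
have wj : kcochain j (t + u) w.
  by apply: kcochainB; [exact: kcochain_shift|exact: kcochain_kdiff].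
have wJ : kcocycle x J i (t + u) w.
  by move=> T Ti; rewrite kdiffB kdiffK subr0 kdiff_shift; apply/idealMl/cJ.
have [u' [b' b'E]] := kcoboundary_of_kcocycle_P vI wj bE wJ.
exists (u + u')%N, (fun S => kprod x S ^+ u' * b S + b' S) => S Si.
have -> : kdiff x (t + (u + u')) (fun S => kprod x S ^+ u' * b S + b' S) S =
   kprod x S ^+ u' * kdiff x (t + u) b S + kdiff x (t + u + u') b' S.
  rewrite addnA -kdiff_shift -big_split; apply: eq_bigr => v _ /=; ring.
move: (b'E S Si); congr (_ \in J); rewrite /w exprD; ring.
Qed.

Lemma vanishes_J_of_I i j :
  vanishes I i j ->
  (forall i' j', i = i'.+1 -> j < j' -> vanishes I i' j') -> vanishes J i j.
Proof.
move=> vI vI1 t c cj cJ; apply: (kcoboundary_of_mod_P vI1 cj cJ).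
have [u [b bE]] := vI t c cj (fun T Ti => sub_J_I (cJ T Ti)).
by exists u, b => S /bE /sub_I_P.
Qed.

Lemma vanishes_J_of_P i j : vanishes P i j ->
  (forall i' j', i = i'.+1 -> j < j' -> vanishes I i' j') -> vanishes J i j.
Proof.
move=> vP vI1 t c cj cJ; apply: (kcoboundary_of_mod_P vI1 cj cJ).
exact: vP cj (fun T Ti => sub_J_P (cJ T Ti)).
Qed.
End LinearForm.
End Graded.

(** * Gradings and quotients of the polynomial ring *)

Section MPolyGrading.
Variables (k : fieldType) (n : nat).
Local Notation R := {mpoly k[n]}.
Implicit Types (Q : ideal R).

Definition mvar (v : 'I_n) : R := 'X_v.

Definition hcomponent (e : int) : {additive R -> R} :=
  match e with
  | Posz d => pihomog mdeg d
  | Negz _ => \0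
  end.

Lemma hcomponentK e p : hcomponent e (hcomponent e p) = hcomponent e p.
Proof. by case: e => d //=; rewrite pihomog_id. Qed.

Lemma hcomponent_fixed e p : hcomponent e p = p <-> mpoly_grading e p.
Proof.
case: e => d /=; first by rewrite homog_piE; split=> /eqP.
by split.
Qed.

Lemma hom_mult_dhomog d (g : R) : g \is d.-homog -> hom_mult hcomponent d g.
Proof.
move=> gd e p; rewrite (pihomog_partitionE (leqnn (mmeasure mdeg p))).
rewrite mulr_sumr !raddf_sum mulr_sumr; apply: eq_bigr => /= a _.
set q := pihomog _ _ _; have qa : q \is (a : nat).-homog by exact: pihomogP.
have gq := dhomogM gd qa.
case: e => m /=.
  have [eam|nam] := eqVneq (a : nat) m.
    by rewrite -eam addnC !pihomog_dE.
  rewrite (pihomog_ne0 nam qa) mulr0 (pihomog_ne0 _ gq) //.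
  by rewrite addnC eqn_add2r.
rewrite mulr0; case E : (Negz m + d%:Z) => [r|r] //=.
by apply: (pihomog_ne0 _ gq); lia.
Qed.

Lemma hcomponent_stable Q : homogeneous_ideal Q -> pr_stable hcomponent Q.
Proof. by move=> hQ [d|d] p pQ /=; [exact: hQ|exact: rpred0]. Qed.

(** A monomial of degree above n * t is divisible by the t-th power of some
variable. *)
Lemma dhomog1_expr_sum (f : R) t : f \is 1.-homog ->
  exists m (g : 'I_n -> R), f ^+ m = \sum_v g v * 'X_v ^+ t.
Proof.
move=> f1; exists (n * t).+1; set m := _.+1.
have fm : f ^+ m \is m.-homog by have := dhomogMn m f1; rewrite mul1n.
have Xg (mu : 'X_{1..n}) : mdeg mu = m ->
    exists g : 'I_n -> R, 'X_[mu] = \sum_v g v * 'X_v ^+ t.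
  move=> mum; have [v tv] : exists v, (t <= mu v)%N.
    apply/existsP; rewrite -[[exists _, _]]negbK; apply/existsPn => lt.
    have : (mdeg mu <= n * t)%N.
      rewrite mdegE -[X in (_ <= X * _)%N]card_ord -sum_nat_const.
      by apply: leq_sum => v _; rewrite ltnW // ltnNge lt.
    by rewrite mum ltnn.
  exists (fun w => if w == v then 'X_[mu - U_(v) *+ t] else 0).
  rewrite (bigD1 v) //= eqxx big1 => [|w /negbTE -> /[!mul0r] //].
  rewrite addr0 mpolyXn -mpolyXD submK //.
  apply/mnm_lepP => w; rewrite mulmnE mnmE.
  by case: eqP => [<-|]; rewrite ?mul1n ?mul0n.
rewrite [f ^+ m]mpolyE big_seq; apply: (big_ind (fun h => exists g : 'I_n -> R,
    h = \sum_v g v * 'X_v ^+ t)).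
- by exists (fun=> 0); rewrite big1 // => v _; rewrite mul0r.
- move=> h h' [g ->] [g' ->]; exists (fun v => g v + g' v).
  by rewrite -big_split; apply: eq_bigr => v _; rewrite mulrDl.
- move=> mu /(dhomogP _ _ _ fm)/Xg[g ->]; exists (fun v => (f ^+ m)@_mu *: g v).
  by rewrite scaler_sumr; apply: eq_bigr => v _; rewrite scalerAl.
Qed.
End MPolyGrading.

Section Quotients.
Local Open Scope quotient_scope.
Variables (k : fieldType) (n : nat).
Local Notation R := {mpoly k[n]}.
Variable (Q : ideal R).
Implicit Types (c b : {set 'I_n} -> R) (S T : {set 'I_n}).
Implicit Types (t u i : nat) (p q : R).
Local Notation X := (@mvar k n).
Let pi p : quot_ideal Q := \pi_(quotmod Q) p.

Lemma pi_eq0 p : pi p = 0 <-> p \in Q.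
Proof.
have := Quotient.idealrBE (submod_pred Q) p 0; rewrite subr0 => E.
have pi0 : pi 0 = 0 by rewrite /pi !piE.
split=> [p0|]; rewrite -[_ \in Q]/(p \in submod_pred Q) E.
  by apply/eqP; exact: etrans p0 (esym pi0).
by move/eqP=> p0; exact: etrans p0 pi0.
Qed.

Lemma piD p q : pi (p + q) = pi p + pi q.
Proof. exact: pi_quotmodD. Qed.

Lemma piM p q : pi (p * q) = p *: pi q.
Proof. exact: pi_quotmod_scale. Qed.

Lemma piB p q : pi (p - q) = pi p - pi q.
Proof. by rewrite piD -mulN1r piM scaleN1r. Qed.

Lemma pi_kdiff t c T : cech_diff (fun S => pi (c S)) t T = pi (kdiff X t c T).
Proof.
rewrite /kdiff /cech_diff [RHS]raddf_sum; apply: eq_bigr => v _.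
by rewrite -2!piM.
Qed.

Lemma eqfrac_pi g p q s s' :
  eqfrac g (pi p) s (pi q) s' <->
  exists u, g ^+ u * (g ^+ s' * p - g ^+ s * q) \in Q.
Proof.
by split=> -[u uE]; exists u; move: uE; rewrite -!piM -piB -piM pi_eq0.
Qed.

Lemma uniform_exponent i (F : {set 'I_n} -> R) :
  (forall S, #|S| = i -> exists u, kprod X S ^+ u * F S \in Q) ->
  exists u, forall S, #|S| = i -> kprod X S ^+ u * F S \in Q.
Proof.
move=> FQ; have /fin_all_exists[u uE] : forall S : {set 'I_n}, exists u,
    #|S| = i -> kprod X S ^+ u * F S \in Q.
  move=> S; have [/FQ[u uE]|Si] := eqVneq #|S| i; first by exists u.
  by exists 0%N => /eqP; rewrite (negbTE Si).
exists (\max_S u S) => S Si; rewrite -(subnK (leq_bigmax S)) exprD -mulrA.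
exact/idealMl/uE.
Qed.

Lemma coboundary_pi i t c :
  coboundary i (fun S => pi (c S)) t <-> kcoboundary X Q i t c.
Proof.
split=> [[b0 [s]]|[u [b bE]]].
  have [b ->] : exists b, b0 = fun S => pi (b S).
    by exists (fun S => repr (b0 S)); apply/funext => S; exact/esym/reprK.
  move=> bE; have [u uE] : exists u, forall S, #|S| = i -> kprod X S ^+ u *
      (kprod X S ^+ s * c S - kprod X S ^+ t * kdiff X s b S) \in Q.
    by apply: uniform_exponent => S /bE; rewrite pi_kdiff => /eqfrac_pi.
  exists (u + s)%N, (fun S => kprod X S ^+ (t + u) * b S) => S Si.
  have -> : (t + (u + s) = s + (t + u))%N by lia.
  rewrite kdiff_shift; move: (uE S Si).
  by congr (_ \in Q); rewrite !exprD; ring.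
exists (fun S => pi (b S)), (t + u)%N => S Si.
rewrite pi_kdiff; apply/eqfrac_pi; exists 0%N.
rewrite expr0 mul1r exprD -mulrA -mulrBr.
exact/idealMl/bE.
Qed.

Lemma cocycle_pi i t c :
  cocycle i (fun S => pi (c S)) t <->
  exists u, kcocycle X Q i (t + u) (fun S => kprod X S ^+ u * c S).
Proof.
split=> [cE|[u uE]].
  have [u uE] : exists u, forall T, #|T| = i.+1 ->
      kprod X T ^+ u * kdiff X t c T \in Q.
    apply: uniform_exponent => T /cE; rewrite pi_kdiff.
    have <- : pi 0 = 0 by apply/pi_eq0/rpred0.
    move=> /eqfrac_pi[u uE]; exists u; move: uE.
    by rewrite mulr0 subr0 expr0 mul1r.
  by exists u => T /uE; rewrite kdiff_shift.
move=> T /uE; rewrite kdiff_shift pi_kdiff => cQ.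
have <- : pi 0 = 0 by apply/pi_eq0/rpred0.
by apply/eqfrac_pi; exists u; rewrite mulr0 subr0 expr0 mul1r.
Qed.

Lemma kcoboundary_shift i t u c :
  kcoboundary X Q i (t + u) (fun S => kprod X S ^+ u * c S) ->
  kcoboundary X Q i t c.
Proof.
move=> [u' [b bE]]; exists (u + u')%N, b => S /bE; rewrite addnA.
by congr (_ \in Q); rewrite exprD; ring.
Qed.

Variable (pr : int -> {additive R -> R}) (G : int -> set (quot_ideal Q)).
Hypothesis X_hom : forall v, hom_mult pr 1 (X v).
Hypothesis GE : forall e m, G e m <-> exists2 p, pr e p = p & pi p = m.

(** Components at index sets of size other than i are unconstrained in
[homog_cochain]; they are lifted to zero. *)
Lemma lift_kcochain i j t (c : {set 'I_n} -> quot_ideal Q) :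
  homog_cochain G i j c t ->
  exists2 p : {set 'I_n} -> R, kcochain pr j t p &
    forall S, #|S| = i -> pi (p S) = c S.
Proof.
move=> cG; have /fin_all_exists[p pE] : forall S, exists q,
    pr (j + (t * #|S|)%:Z) q = q /\ (#|S| = i -> pi q = c S).
  move=> S; have [Si|Si] := eqVneq #|S| i; last first.
    by exists 0; rewrite raddf0; split=> // /eqP; rewrite (negbTE Si).
  by have /GE[q] := cG S Si; rewrite -Si; exists q.
by exists p => S; have [] := pE S.
Qed.

(** The degree j part of the direct limit: since an equation between fractions
holds after multiplication by one common power of the variables, a Cech cocycle
is a Koszul cocycle of a higher level. *)
Lemma loccoh_comp_neq0P i j :
  loccoh_comp_neq0 G i j <-> ~ vanishes X pr Q i j.
Proof.
split=> [[c [t [cG cZ cB]]] van|/existsNP[t /existsNP[c]]].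
  have [p pj pE] := lift_kcochain cG.
  have : cocycle i (fun S => pi (p S)) t.
    move=> T Ti; have := cZ T Ti; congr (eqfrac _ _ _ _ _).
    apply: eq_bigr => v vT; rewrite pE //.
    by move: Ti; rewrite (cardsD1 v) vT => -[].
  move=> /cocycle_pi[u uE]; apply: cB.
  have /coboundary_pi[b [s bE]] : kcoboundary X Q i t p.
    by apply/kcoboundary_shift/van/uE; exact: kcochain_shift.
  by exists b, s => S Si; rewrite -pE //; apply: bE.
move=> /not_implyP[cj /not_implyP[cZ cB]].
exists (fun S => pi (c S)), t; split.
- by move=> S Si; apply/GE; exists (c S); rewrite // -Si.
- apply/cocycle_pi; exists 0%N => T Ti; rewrite addn0.
  rewrite (_ : kdiff _ _ _ _ = kdiff X t c T) ?cZ //.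
  by apply: eq_bigr => v _; rewrite expr0 mul1r.
- by move/coboundary_pi.
Qed.

End Quotients.

(** * Extremal degrees of three related families *)

Section ExtremalDegrees.
Local Open Scope classical_set_scope.

Lemma nat_least (P : nat -> Prop) : (exists m, P m) ->
  exists m, P m /\ forall m', P m' -> (m <= m')%N.
Proof.
move=> [m0 Pm0]; have ex : exists m, `[< P m >] by exists m0; apply/asboolP.
case: (ex_minnP ex) => m /asboolP Pm mmin; exists m; split=> // m' Pm'.
exact/mmin/asboolP.
Qed.

Definition first_index (N : nat -> Prop) : \bar int :=
  infimum +oo%E [set d | exists2 i, N i & d = (i%:Z)%:E].

Lemma first_index_least (N : nat -> Prop) i : N i ->
  (forall i', (i' < i)%N -> ~ N i') -> first_index N = (i%:Z)%:E.
Proof.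
move=> Ni lti; rewrite /first_index /infimum.
set A := [set _ | _]; have Ai : A (i%:Z)%:E by exists i.
have infi : infimums A (i%:Z)%:E.
  split=> [_ [i' Ni' ->]|y]; last exact.
  by rewrite lee_fin lez_nat leqNgt; apply/negP => /lti.
case: ifPn => [/eqP A0|_]; first by move: Ai; rewrite A0.
case: xgetP => [y _ infy|/(_ _ infi)//].
exact: is_subset1_infimums infy infi.
Qed.

Lemma first_index_none (N : nat -> Prop) :
  (forall i, ~ N i) -> first_index N = +oo%E.
Proof.
move=> noN; rewrite /first_index /infimum.
by case: ifPn => // /set0P[d [i Ni _]]; case: (noN i Ni).
Qed.

(** Here A, B, D stand for the nonvanishing of the local cohomology of R / P,
R / I, R / J. *)
Lemma first_index_alternative (A B D : nat -> Prop) :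
  (forall i, ~ D i -> ~ B i -> ~ A i) ->
  (forall i, ~ D i -> ~ D i.+1 -> ~ A i -> ~ B i) ->
  (forall i, ~ B i -> (forall i', i = i'.+1 -> ~ B i') -> ~ D i) ->
  (forall i, ~ A i -> (forall i', i = i'.+1 -> ~ B i') -> ~ D i) ->
  first_index B = first_index A \/ first_index B = (first_index D - 1%:E)%E.
Proof.
move=> DBA DAB BD AD.
have [/nat_least[b [Bb bmin]]|noB] := pselect (exists i, B i); last first.
  have nB i : ~ B i by move=> Bi; apply: noB; exists i.
  by right; rewrite !first_index_none // => i; apply: BD.
have nB i : (i < b)%N -> ~ B i by move=> ib /bmin; rewrite leqNgt ib.
have nB' i : (i <= b)%N -> forall i', i = i'.+1 -> ~ B i'.
  by move=> ib i' e; apply: nB; rewrite -e.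
have nD i : (i < b)%N -> ~ D i.
  by move=> ib; apply: BD; [exact: nB|exact/nB'/ltnW].
rewrite (first_index_least Bb) //.
have [Ab|nA] := pselect (A b).
  left; rewrite (first_index_least Ab) // => i ib.
  by apply: DBA; [exact: nD|exact: nB].
have nDb : ~ D b by apply: AD nA (nB' b (leqnn b)).
have Db : D b.+1 by apply: contrapT => nDb1; exact: DAB nDb nDb1 nA Bb.
right; rewrite (first_index_least Db) => [|i].
  by rewrite -EFinB; congr (_%:E); lia.
by rewrite ltnS leq_eqVlt => /orP[/eqP -> //|]; exact: nD.
Qed.

Definition top_weight (N : nat -> int -> Prop) : \bar int :=
  supremum -oo%E [set r | exists i j, N i j /\ r = (i%:Z + j)%:E].

(** Unbounded and empty sets have infinite least upper bounds; this is why the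
regularity can be compared without proving beforehand that it is finite. *)
Lemma int_lub (S : int -> Prop) : exists r : \bar int,
  (forall z, S z -> (z%:E <= r)%E) /\
  forall r', (forall z, S z -> (z%:E <= r')%E) -> (r <= r')%E.
Proof.
have [[N NS]|unb] := pselect (exists N : int, forall z, S z -> z <= N);
  last first.
  exists +oo%E; split=> [z _|]; first exact: leey.
  case=> [z Sz||]; rewrite ?lexx //.
  - by case: unb; exists z => z' /Sz.
  - by move=> Sz; case: unb; exists 0 => z /Sz.
have [[z0 Sz0]|S0] := pselect (exists z, S z); last first.
  by exists -oo%E; split=> [z Sz|*]; [case: S0; exists z|exact: leNye].
have [|m [Sm mmin]] := @nat_least (fun m => S (N - m%:Z)).
  exists `|N - z0|%N; have := NS _ Sz0 => zN.
  by rewrite (_ : N - _ = z0) //; lia.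
exists (N - m%:Z)%:E; split=> [z Sz|r']; last exact.
have zN := NS _ Sz; rewrite lee_fin.
have := mmin `|N - z|%N; rewrite (_ : N - `|N - z|%N%:Z = z); last by lia.
by move=> /(_ Sz); lia.
Qed.

Lemma top_weight_lub (N : nat -> int -> Prop) :
  (forall i j, N i j -> ((i%:Z + j)%:E <= top_weight N)%E) /\
  forall r, (forall i j, N i j -> ((i%:Z + j)%:E <= r)%E) ->
    (top_weight N <= r)%E.
Proof.
rewrite /top_weight; set A := [set _ | _].
have [r [rub rlub]] := int_lub (fun z => exists i j, N i j /\ z = i%:Z + j).
have supr : supremums A r.
  split=> [_ [i [j [Nij ->]]]|r' r'ub]; first by apply: rub; exists i, j.
  by apply: rlub => _ [i [j [Nij ->]]]; apply: r'ub; exists i, j.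
rewrite /supremum; case: ifPn => [/eqP A0|_].
  split=> [i j Nij|*]; last exact: leNye.
  by have : A (i%:Z + j)%:E by [exists i, j]; rewrite A0.
case: xgetP => [r' _ [ub lub]|/(_ _ supr)//]; split=> [i j Nij|r'' r''ub].
  by apply: ub; exists i, j.
by apply: lub => _ [i [j [Nij ->]]]; exact: r''ub.
Qed.

(** With A, B, D as in [first_index_alternative]: the last hypothesis makes the
weights of D at most the supremum for B; above the weights of D, the other two
match the elements of B with those of A one weight below. *)
Lemma top_weight_alternative (A B D : nat -> int -> Prop) :
  (forall i j, ~ D i j -> ~ B i (j + 1) -> ~ A i j) ->
  (forall i j, ~ D i (j + 1) -> ~ D i.+1 j -> ~ A i j -> ~ B i (j + 1)) ->
  (forall i j, ~ B i j -> (forall i' j', i = i'.+1 -> j < j' -> ~ B i' j') ->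
    ~ D i j) ->
  top_weight B = (top_weight A + 1%:E)%E \/ top_weight B = top_weight D.
Proof.
move=> DBA DAB BD.
move: (top_weight_lub A) (top_weight_lub B) (top_weight_lub D).
move: (top_weight A) (top_weight B) (top_weight D).
move=> a b d [Aub Alub] [Bub Blub] [Dub Dlub].
have above N r i j : (forall i j, N i j -> ((i%:Z + j)%:E <= r)%E) ->
    (r < (i%:Z + j)%:E)%E -> ~ N i j.
  by move=> ub lt /ub; rewrite leNgt lt.
have db : (d <= b)%E.
  apply: (Dlub) => i j Dij; rewrite leNgt; apply/negP => bij; move: Dij.
  apply: BD => [|i' j' e jj']; apply: (above _ _ _ _ Bub) => //.
  by apply: lt_le_trans bij _; rewrite lee_fin; lia.
move: db; rewrite le_eqVlt => /orP[/eqP ->|db]; [by right|left].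
have BA i j : (d < (i%:Z + j)%:E)%E -> B i j -> ((i%:Z + j)%:E <= a + 1%:E)%E.
  move=> dij Bij; have : A i (j - 1).
    apply: contrapT => nA; move: Bij; rewrite -[j](subrK 1); apply: (DAB) => //.
      by apply: (above _ _ _ _ Dub); rewrite subrK.
    by apply: (above _ _ _ _ Dub); rewrite (_ : _ + _ = i%:Z + j) //; lia.
  move=> /Aub; rewrite -leeBlDr // -EFinB.
  by rewrite (_ : i%:Z + (j - 1) = i%:Z + j - 1) //; lia.
apply/eqP; rewrite eq_le; apply/andP; split.
  apply: (Blub) => i j Bij.
  have [ijd|] := leP ((i%:Z + j)%:E) d; last by move/BA; apply.
  (* A small weight is dominated by that of any element of B above d. *)
  have [i0 [j0 [Bij0 dij0]]] : exists i0 j0, B i0 j0 /\ (d < (i0%:Z + j0)%:E)%E.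
    apply: contrapT => no; move: db; rewrite ltNge => /negP; apply.
    apply: (Blub) => i0 j0 Bij0; rewrite leNgt; apply/negP => dij0.
    by apply: no; exists i0, j0.
  exact: le_trans ijd (le_trans (ltW dij0) (BA _ _ dij0 Bij0)).
rewrite -leeBrDr //; apply: (Alub) => i j Aij.
rewrite leeBrDr // leNgt; apply/negP => bij; move: Aij; apply: DBA.
  apply: (above _ _ _ _ Dub); apply: lt_le_trans db _.
  move: bij; rewrite -EFinD.
  by case: (b) => [z||]; rewrite ?leNye // lte_fin lee_fin; lia.
by apply: (above _ _ _ _ Bub); rewrite addrA.
Qed.

End ExtremalDegrees.

(** * Depth and regularity of quotients *)

Section Vanishing.
Variables (k : fieldType) (n : nat).
Local Notation R := {mpoly k[n]}.
Implicit Types Q : ideal R.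

Local Notation X := (@mvar k n).

Definition ungraded_pr (e : int) : {additive R -> R} := idfun.

(** With identity projections all degrees give the same proposition; 0 stands
for any of them. *)
Lemma loccoh_eq0P Q i :
  ~ loccoh_neq0 (quot_ideal Q) i <-> vanishes X ungraded_pr Q i 0.
Proof.
pose G := fun _ : int => [set: quot_ideal Q]%classic.
have E : loccoh_comp_neq0 G i 0 <-> ~ vanishes X ungraded_pr Q i 0.
  apply: loccoh_comp_neq0P => // e m; split=> // _.
  by exists (repr m) => //; exact: reprK.
have E' : loccoh_neq0 (quot_ideal Q) i <-> loccoh_comp_neq0 G i 0.
  by split=> [[c [t [cZ cB]]]|[c [t [_ cZ cB]]]]; exists c, t.
by rewrite E' E; split=> [/contrapT|van /(_ van)].
Qed.

Lemma loccoh_comp_eq0P Q i j :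
  ~ loccoh_comp_neq0 (@quot_grading k n Q) i j <->
  vanishes X (@hcomponent k n) Q i j.
Proof.
have E : loccoh_comp_neq0 (@quot_grading k n Q) i j <->
    ~ vanishes X (@hcomponent k n) Q i j; last first.
  by rewrite E; split=> [/contrapT|van /(_ van)].
apply: loccoh_comp_neq0P.
- by move=> v; apply: hom_mult_dhomog; rewrite dhomogX; apply/eqP/mdeg1.
- by move=> e m; split=> -[p /hcomponent_fixed pe <-]; exists p.
Qed.

End Vanishing.

Theorem theorem3p1 (k : fieldType) (n : nat)
    (J H : ideal {mpoly k[n]}) (f : {mpoly k[n]}) :
  homogeneous_ideal J -> homogeneous_ideal H ->
  f \is 1.-homog ->
  nonzerodivisor f (quot_ideal J) ->
  let I := ideal_add J (ideal_scale f H) in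
  (depth_quot I = depth_quot (ideal_add J H) \/
   depth_quot I = (depth_quot J - 1%:E)%E) /\
  (reg_quot I = (reg_quot (ideal_add J H) + 1%:E)%E \/
   reg_quot I = reg_quot J).
Proof.
move=> Jh Hh f1 freg I; set P := ideal_add J H.
have f_reg g : f * g \in J -> g \in J.
  by move=> fg; apply/pi_eq0/freg; rewrite -piM; apply/pi_eq0.
have sub_J_P g : g \in J -> g \in P.
  by move=> gJ; apply/asboolP; exists g => //; exists 0; rewrite ?rpred0 ?addr0.
have IE g : g \in I <-> exists2 p, p \in P & g - f * p \in J.
  split=> [/asboolP[a aJ [_ /asboolP[h hH ->] ->]]|].
    exists h; last by rewrite addrK.
    by apply/asboolP; exists 0; [exact: rpred0|exists h; rewrite ?add0r].
  move=> [p /asboolP[a aJ [h hH ->]] gJ].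
  apply/asboolP; exists (g - f * (a + h) + f * a).
    by apply: rpredD => //; exact: idealMl.
  exists (f * h); first by apply/asboolP; exists h.
  by rewrite mulrDr; ring.
have f_nilp t := dhomog1_expr_sum t f1.
split.
  have stable (Q : ideal {mpoly k[n]}) : pr_stable (@ungraded_pr k n) Q by [].
  have prK e p : @ungraded_pr k n e (ungraded_pr k n e p) = p by [].
  have X_hom v : hom_mult (@ungraded_pr k n) 1 (@mvar k n v) by [].
  have f_hom : hom_mult (@ungraded_pr k n) 1 f by [].
  have [Js Ps] := (stable J, stable P).
  apply: first_index_alternative => i.
  - move=> /loccoh_eq0P vJ /loccoh_eq0P vI; apply/loccoh_eq0P.
    exact: (vanishes_P prK X_hom f_hom f_reg sub_J_P IE Js Ps vJ vI).
  - move=> /loccoh_eq0P vJ /loccoh_eq0P vJ1 /loccoh_eq0P vP.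
    apply/loccoh_eq0P.
    exact: (vanishes_I prK X_hom f_hom f_reg sub_J_P IE Js Ps vJ vJ1 vP).
  - move=> /loccoh_eq0P vI vI1; apply/loccoh_eq0P.
    apply: (vanishes_J_of_I prK X_hom f_hom f_nilp f_reg sub_J_P IE Js Ps vI).
    by move=> i' j' /vI1 /loccoh_eq0P.
  - move=> /loccoh_eq0P vP vI1; apply/loccoh_eq0P.
    apply: (vanishes_J_of_P prK X_hom f_hom f_nilp f_reg sub_J_P IE Js Ps vP).
    by move=> i' j' /vI1 /loccoh_eq0P.
have prK := @hcomponentK k n.
have X_hom v : hom_mult (@hcomponent k n) 1 (@mvar k n v).
  by apply: hom_mult_dhomog; rewrite dhomogX; apply/eqP/mdeg1.
have f_hom := hom_mult_dhomog f1.
have Js := hcomponent_stable Jh; have Hs := hcomponent_stable Hh.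
have Ps : pr_stable (@hcomponent k n) P.
  move=> e _ /asboolP[a aJ [h hH ->]]; apply/asboolP.
  exists (hcomponent k n e a); first exact: Js.
  by exists (hcomponent k n e h); [exact: Hs|exact: raddfD].
apply: top_weight_alternative => i j.
- move=> /loccoh_comp_eq0P vJ /loccoh_comp_eq0P vI; apply/loccoh_comp_eq0P.
  exact: (vanishes_P prK X_hom f_hom f_reg sub_J_P IE Js Ps vJ vI).
- move=> /loccoh_comp_eq0P vJ /loccoh_comp_eq0P vJ1 /loccoh_comp_eq0P vP.
  apply/loccoh_comp_eq0P.
  exact: (vanishes_I prK X_hom f_hom f_reg sub_J_P IE Js Ps vJ vJ1 vP).
- move=> /loccoh_comp_eq0P vI vI1; apply/loccoh_comp_eq0P.
  apply: (vanishes_J_of_I prK X_hom f_hom f_nilp f_reg sub_J_P IE Js Ps vI).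
  by move=> i' j' ei jj'; apply/loccoh_comp_eq0P/vI1.
Qed.
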